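(* Let $m\ge 3$, $n\ge 2$ and $2\le l\le\lceil n/2\rceil$. For every positive integer $k$, $$\chi^b_{B_l^*(m,n)}(2k)=\Big[\sum_{i=0}^{m-2}(-1)^i(2k-1)^{(m-2)-i}\Big]\,\chi^b_{B_{l-1}^*(m,n-1)}(2k).$$
   Context: A signed graph $(G,\sigma)$ is a finite graph $G$ with a sign function $\sigma:E(G)\to\{+1,-1\}$; its signature is the set of negative edges. A zero-free signed coloring in $2k$ colors is a map $c:V(G)\to\{-k,\dots,-1,1,\dots,k\}$; it is proper if $c(y)\neq\sigma(e)c(x)$ for every edge $e=xy$. The balanced chromatic polynomial $\chi^b_{(G,\sigma)}(2k)$ is the number of proper zero-free signed colorings in $2k$ colors. For integers $m\ge 3$, $n\ge 1$, the Book graph $B(m,n)$ has vertex set $\{u,v\}\cup\{u_j^l:1\le l\le n,\,1\le j\le m-2\}$ and consists of the $n$ cycles $u\,u_1^l\cdots u_{m-2}^l\,v\,u$ sharing the edge $uv$. For $1\le l\le n$, $B_l^*(m,n)$ denotes $B(m,n)$ with signature $\{uv,uu_1^1,\dots,uu_1^{l-1}\}$. *)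

(* Defs.v *)
From HB Require Import structures.
From mathcomp Require Import all_boot all_order all_algebra.

Set Implicit Arguments.
Unset Strict Implicit.
Unset Printing Implicit Defensive.

Import Order.TTheory GRing.Theory Num.Theory.

Local Open Scope ring_scope.

Record graph := Graph {
  vertex : finType;
  edges : {set {set vertex}};
  edgesP : forall e, e \in edges -> #|e| = 2%N }.

Definition edge (G : graph) := {e : {set vertex G} | e \in edges G}.

Record signed_graph := SignedGraph {
  base :> graph;
  sign : edge base -> int;
  signP : forall e, sign e \in [:: 1; -1] }.

Definition signature (G : signed_graph) : {set {set vertex G}} :=
  [set val e | e : edge G & sign e == -1].

Section WithSignature.
Variables (G : graph) (S : {set {set vertex G}}).

Definition sign_of (e : edge G) : int := if val e \in S then -1 else 1.

Lemma sign_ofP e : sign_of e \in [:: 1; -1].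
Proof. by rewrite /sign_of; case: ifP. Qed.

Definition with_signature : signed_graph := SignedGraph sign_ofP.

Lemma with_signatureE : S \subset edges G -> signature with_signature = S.
Proof.
move=> sSE; apply/setP=> e; apply/imsetP/idP => [[f]|eS].
  by rewrite inE /= /sign_of => + ->; case: ifP.
by exists (exist _ e (subsetP sSE _ eS)); rewrite // inE /= /sign_of /= eS.
Qed.
End WithSignature.

(* The list -k, ..., -1, 1, ..., k, up to order. *)
Definition zero_free_colors (k : nat) : seq int :=
  [seq - j%:Z | j <- iota 1 k] ++ [seq j%:Z | j <- iota 1 k].

Definition zero_free_coloring (V : finType) (k : nat) :=
  {ffun V -> seq_sub (zero_free_colors k)}.

Definition proper (G : signed_graph) (k : nat)
    (c : zero_free_coloring (vertex G) k) : bool :=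
  [forall e : edge G, forall x, forall y,
    (val e == [set x; y]) ==> (val (c y) != sign e * val (c x))].

(* The value at 2k, not at k, of the balanced chromatic polynomial. *)
Definition balanced_chromatic (G : signed_graph) (k : nat) : nat :=
  #|[set c : zero_free_coloring (vertex G) k | proper c]|.

Definition cycle_edges (V : finType) (s : seq V) : {set {set V}} :=
  [set [set x; next s x] | x in s].

Lemma next_neq (V : eqType) (s : seq V) (x : V) :
  uniq s -> (1 < size s)%N -> x \in s -> x != next s x.
Proof.
move=> us s_gt1 xs; have [i s' Es] := rot_to xs.
have us' : uniq (x :: s') by rewrite -Es rot_uniq.
rewrite -(next_rot i us) Es; case: s' Es us' => [|y s'] Es.
  by move: s_gt1; rewrite -(size_rot i) Es.
by rewrite /= eqxx inE negb_or; case/andP=> /andP[].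
Qed.

Section Book.
Variables m n : nat.

(* inl false is u, inl true is v, and inr (l, j) is u_{j+1}^{l+1}: pages and
   positions on a page are numbered from 0. *)
Definition book_vertex : finType := (bool + 'I_n * 'I_(m - 2))%type.

Definition bu : book_vertex := inl false.
Definition bv : book_vertex := inl true.
Definition bw (l : 'I_n) (j : 'I_(m - 2)) : book_vertex := inr (l, j).

Definition book_cycle (l : 'I_n) : seq book_vertex :=
  bu :: rcons [seq bw l j | j <- enum 'I_(m - 2)] bv.

Definition book_edges : {set {set book_vertex}} :=
  \bigcup_(l < n) cycle_edges (book_cycle l).

Lemma book_edgesP e : e \in book_edges -> #|e| = 2%N.
Proof.
case/bigcupP=> l _ /imsetP[x xC ->].
rewrite cards2 next_neq //; last by rewrite /= size_rcons.
rewrite /= mem_rcons inE rcons_uniq map_inj_uniq ?enum_uniq; last first.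
  by move=> i j [].
by rewrite andbT /=; apply/andP; split; apply/mapP=> -[].
Qed.

Definition book : graph := Graph book_edgesP.

(* The edges uv and u u_1^1, ..., u u_1^(l-1), in the 0-based numbering above. *)
Definition book_signature (l : nat) : {set {set book_vertex}} :=
  [set bu; bv] |:
  [set [set bu; bw i j] | i in 'I_n, j in 'I_(m - 2)
    & (i < l - 1)%N && (j == 0%N :> nat)].

Definition book_star (l : nat) : signed_graph :=
  @with_signature book (book_signature l).

Lemma book_star_signature l : (2 < m)%N -> (0 < n)%N ->
  signature (book_star l) = book_signature l.
Proof.
move=> m_gt2 n_gt0; apply: with_signatureE; apply/subsetP=> e /=.
case/setU1P=> [->|/imset2P[i j _]].
  apply/bigcupP; exists (Ordinal n_gt0) => //; apply/imsetP; exists bv.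
    by rewrite inE mem_rcons mem_head orbT.
  rewrite setUC /book_cycle; congr [set _; _]; set s := map _ _.
  have vNs : bv \notin s by apply/mapP=> -[].
  have: forall y, y != bv -> next_at bv bu y (rcons s bv) = bu.
    elim: s vNs => [|z t IHt] vNt y yv; rewrite /= eq_sym (negPf yv) //.
    by move: vNt; rewrite inE negb_or eq_sym => /andP[vz vt]; apply: IHt.
  by move=> /(_ bu isT) /= ->.
rewrite !inE => /andP[_ /andP[_ /eqP j0]] ->.
apply/bigcupP; exists i => //; apply/imsetP; exists bu; first exact: mem_head.
congr [set _; _]; rewrite /book_cycle.
have -> : enum 'I_(m - 2) = j :: behead (enum 'I_(m - 2)).
  have: (0 < size (enum 'I_(m - 2)))%N by rewrite size_enum_ord subn_gt0.
  case E: (enum _) => [|h t] //= _; congr (_ :: _); apply: val_inj.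
  by rewrite /= j0 -[h]/(nth j (h :: t) 0) -E nth_enum_ord // subn_gt0.
by [].
Qed.
End Book.

(* Main.v *)
Require Import Defs.
From mathcomp Require Import all_boot all_order all_algebra.

Import Order.TTheory GRing.Theory Num.Theory.

Local Open Scope ring_scope.

Set Implicit Arguments.
Unset Strict Implicit.
Unset Printing Implicit Defensive.

(** The negative edge [uv] forces [c(v) <> - c(u)] in every proper coloring [c].
    A page whose first edge is negative is a path colored properly in the
    unsigned sense between the end colors [- c(u)] and [c(v)], which are thus
    always distinct; so it can be colored in a number of ways independent of
    the coloring of the rest of the book.  That number is computed from the
    recurrence [N (p + 1) x b = (q - 1) ^ (p + 1) - N p x b] for the number of
    proper [q]-colorings of [p] inner vertices of a path with end colors
    [x] and [b]. *)

(** * Proper colorings of a path with prescribed end colors *)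

Section PathColorings.
Variable T : finType.

Definition neq_rel : rel T := fun x y => x != y.

Definition path_colorings (p : nat) (x b : T) : nat :=
  #|[set t : p.-tuple T | path neq_rel x (rcons t b)]|.

Lemma path_colorings0 x b : path_colorings 0 x b = (x != b).
Proof.
rewrite /path_colorings; case: (boolP (x != b)) => xb.
  rewrite (_ : [set _ | _] = setT) ?cardsT ?card_tuple ?expn0 //.
  by apply/setP=> t; rewrite !inE tuple0 /= /neq_rel xb.
by apply/eqP; rewrite cards_eq0; apply/eqP/setP=> t;
  rewrite !inE tuple0 /= /neq_rel (negPf xb).
Qed.

Lemma path_coloringsS p x b :
  path_colorings p.+1 x b = (\sum_(y | x != y) path_colorings p y b)%N.
Proof.
rewrite /path_colorings -sum1dep_card.
pose h (yt : T * p.-tuple T) : p.+1.-tuple T := [tuple of yt.1 :: yt.2].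
have h_bij : bijective h.
  exists (fun t => (thead t, [tuple of behead t])) => [[y t]|t].
    by congr pair; apply: val_inj.
  by rewrite /h /= -tuple_eta.
rewrite (reindex h) /=; last exact: onW_bij.
rewrite -(pair_big_dep (fun y => x != y)
  (fun y (t : p.-tuple T) => path neq_rel y (rcons t b)) (fun _ _ => 1%N)) /=.
by apply: eq_bigr => y _; rewrite sum1dep_card.
Qed.

(** Coloring the path backward from [b], with the start free as well, leaves [#|T| - 1] choices at
    each of the [p + 1] vertices. *)
Lemma sum_path_colorings p b :
  (\sum_x path_colorings p x b)%N = (#|T|.-1 ^ p.+1)%N.
Proof.
have cardN (y : T) : #|[pred x | x != y]| = #|T|.-1
  by rewrite -(cardC1 y); apply: eq_card.
elim: p => [|p IHp].
  under eq_bigr do rewrite path_colorings0.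
  by rewrite -big_mkcond /= sum1_card cardN.
under eq_bigr do rewrite path_coloringsS.
rewrite (exchange_big_dep predT) //= expnSr -IHp big_distrl /=.
by apply: eq_bigr => y _; rewrite sum_nat_const cardN mulnC.
Qed.

Lemma path_colorings_neq p x b : x != b ->
  (path_colorings p x b)%:Z =
  \sum_(0 <= i < p.+1) (-1) ^+ i * (#|T|%:Z - 1) ^+ (p - i).
Proof.
have cardE : #|T|%:Z - 1 = #|T|.-1%:Z.
  have: (0 < #|T|)%N by apply/card_gt0P; exists x.
  by case: #|T| => // q _; rewrite -addn1 PoszD addrK addn1.
move=> xb; elim: p => [|p IHp].
  by rewrite path_colorings0 xb big_nat1 subnn !expr0 mulr1.
(* Once the start color [x] is split off, the remaining sum runs over the colors allowed next to
   [x], so it counts the colorings with [p + 1] inner vertices. *)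
have := sum_path_colorings p b; rewrite (bigD1 x) //=.
under eq_bigl do rewrite eq_sym.
rewrite -path_coloringsS => /(congr1 Posz); rewrite PoszD IHp => sumE.
rewrite big_nat_recl // expr0 mul1r subn0.
under eq_bigr do rewrite subSS exprS mulN1r mulNr.
have -> : (#|T|%:Z - 1) ^+ p.+1 = (#|T|.-1 ^ p.+1)%N.
  by rewrite cardE -[RHS]natz natrX natz.
by rewrite sumrN -sumE addrC addKr.
Qed.
End PathColorings.
Arguments neq_rel {T}.

(** * The [2 * k] colors and their negation *)

Section ZeroFreeColors.
Variable k : nat.

Let T := seq_sub (zero_free_colors k).

Lemma zero_free_colorsE (z : int) :
  (z \in zero_free_colors k) = (0 < `|z| <= k)%N.
Proof.
rewrite mem_cat; apply/orP/idP.
  by case=> /mapP[j]; rewrite mem_iota add1n ltnS => jk ->; rewrite ?abszN.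
move=> zk; case: (ltrP z 0) => z0; [left|right]; apply/mapP;
  exists `|z|%N; rewrite ?mem_iota ?add1n ?ltnS //.
  by rewrite ltz0_abs // opprK.
by rewrite gez0_abs.
Qed.

(** The two halves of the list could meet only in 0, which neither contains. *)
Lemma zero_free_colors_uniq : uniq (zero_free_colors k).
Proof.
have pos_inj : injective Posz by move=> i j [].
have neg_inj : injective (fun j => - Posz j) by move=> i j /oppr_inj[].
rewrite cat_uniq !map_inj_uniq ?iota_uniq //= andbT.
apply/hasPn => z /mapP[i]; rewrite mem_iota => /andP[i0 _] ->.
apply/negP=> /mapP[j]; rewrite mem_iota => /andP[j0 _].
by case: i j i0 j0 => [|i] [|j].
Qed.

Lemma card_zero_free_colors : #|{: T}| = (2 * k)%N.
Proof.
rewrite card_seq_sub ?zero_free_colors_uniq //.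
by rewrite size_cat !size_map !size_iota addnn mul2n.
Qed.

Lemma opp_color_subproof (x : T) : - val x \in zero_free_colors k.
Proof. by rewrite zero_free_colorsE abszN -zero_free_colorsE (valP x). Qed.

Definition opp_color (x : T) : T := SeqSub (opp_color_subproof x).

Lemma opp_colorK : involutive opp_color.
Proof. by move=> x; apply: val_inj; rewrite /= opprK. Qed.

End ZeroFreeColors.

(** * Properness as a relation between consecutive vertices of a cycle *)

Section ProperColorings.
Variable k : nat.

(** Defined on all pairs of vertices, edges or not, so that [path] and [cycle] apply to it. *)
Definition compatible (V : finType) (S : {set {set V}})
    (c : zero_free_coloring V k) : rel V :=
  fun x y => c y != if [set x; y] \in S then opp_color (c x) else c x.

Lemma compatible_sym V S c : symmetric (@compatible V S c).
Proof.
move=> x y; rewrite /compatible setUC; case: ifP => _; last by rewrite eq_sym.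
by rewrite -(inj_eq (can_inj (@opp_colorK _))) opp_colorK eq_sym.
Qed.

Lemma proper_with_signatureP (G : graph) S
    (c : zero_free_coloring (vertex G) k) :
  reflect (forall x y, [set x; y] \in edges G -> compatible S c x y)
          (@Defs.proper (@with_signature G S) k c).
Proof.
apply: (iffP forallP) => [cP x y xyE|cP e].
  have /forallP/(_ x)/forallP/(_ y)/implyP := cP (Sub [set x; y] xyE).
  rewrite /= eqxx => /(_ isT); apply: contraNneq => ->.
  by rewrite /sign_of /=; case: ifP => _; rewrite ?mulN1r ?mul1r.
apply/forallP=> x; apply/forallP=> y; apply/implyP=> /eqP eE.
have := cP x y; rewrite -eE => /(_ (valP e)); rewrite /compatible -eE.
apply: contraNneq => cE; apply/eqP/val_inj; rewrite cE /= /sign_of.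
by case: ifP => _; rewrite ?mulN1r ?mul1r.
Qed.

Lemma cycle_compatibleP (V : finType) S (c : zero_free_coloring V k) s :
  uniq s ->
  reflect (forall x y, [set x; y] \in cycle_edges s -> compatible S c x y)
          (cycle (compatible S c) s).
Proof.
move=> s_uniq; apply: (iffP idP) => [cyc x y /imsetP[z zs xyE]|cP].
  have cz := next_cycle cyc zs.
  have: x \in [set z; next s z] by rewrite -xyE set21.
  have: y \in [set z; next s z] by rewrite -xyE set22.
  have: z \in [set x; y] by rewrite xyE set21.
  have: next s z \in [set x; y] by rewrite xyE set22.
  (* In the first and last cases [x] and [y] coincide, which forces [next s z = z]; the other two
     are the two orientations of one edge. *)
  rewrite !inE => + + /orP[]/eqP yE /orP[]/eqP xE; rewrite {}xE {}yE ?orbb.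
  - by move=> /eqP nz _; rewrite nz in cz.
  - by rewrite compatible_sym.
  - by [].
  - by move=> _ /eqP zn; rewrite -zn in cz *.
apply: cycle_from_next => // x xs; apply: cP.
by apply/imsetP; exists x.
Qed.

End ProperColorings.

(** * Colorings of the book, one page at a time *)

Section BookColorings.
Variables m k : nat.

Definition page_colors n (c : zero_free_coloring (book_vertex m n) k)
  (i : 'I_n) : (m - 2).-tuple _ := [tuple c (bw i j) | j < m - 2].

(* The sign of the first edge of page [i] is absorbed into the color of [u]. *)
Definition page_start n l (c : zero_free_coloring (book_vertex m n) k)
    (i : 'I_n) :=
  if (i < l - 1)%N then opp_color (c (bu m n)) else c (bu m n).

Lemma book_cycle_uniq n (i : 'I_n) : uniq (book_cycle m i).
Proof.
rewrite /= mem_rcons inE rcons_uniq map_inj_uniq ?enum_uniq; last first.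
  by move=> a b [].
by rewrite andbT /=; apply/andP; split; apply/mapP=> -[].
Qed.

Lemma book_signature_uv n l : [set bu m n; bv m n] \in book_signature m n l.
Proof. exact: setU11. Qed.

Lemma book_signature_page n l (i : 'I_n) (j : 'I_(m - 2)) :
  ([set bu m n; bw i j] \in book_signature m n l) =
  (i < l - 1)%N && (j == 0%N :> nat).
Proof.
rewrite in_setU1; case: eqP => [/setP/(_ (bw i j))|_] /=.
  by rewrite !inE eqxx.
apply/imset2P/idP => [[i' j' _ + /setP/(_ (bw i j))]|ij].
  by rewrite !inE eqxx /= => ij /esym/eqP[-> ->].
by exists i j; rewrite // !inE.
Qed.

(** Every negative edge contains [u], so beyond its first edge a page behaves as an unsigned
    path. *)
Lemma book_signature_notu n l x y : x != bu m n -> y != bu m n ->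
  [set x; y] \notin book_signature m n l.
Proof.
move=> xu yu; apply: contraT; rewrite negbK => xyS.
have: bu m n \in [set x; y].
  case/setU1P: xyS => [->|/imset2P[i j _ _ ->]]; exact: set21.
by rewrite !inE !(eq_sym (bu m n)) (negPf xu) (negPf yu).
Qed.

Lemma cycle_book n l (c : zero_free_coloring (book_vertex m n) k) (i : 'I_n) :
  (2 < m)%N ->
  cycle (compatible (book_signature m n l) c) (book_cycle m i) =
  (c (bv m n) != opp_color (c (bu m n))) &&
  path neq_rel (page_start l c i) (rcons (page_colors c i) (c (bv m n))).
Proof.
move=> m_gt2; rewrite /book_cycle /= rcons_path last_rcons andbC.
rewrite compatible_sym {1}/compatible book_signature_uv; congr andb.
have -> : rcons (page_colors c i) (c (bv m n))
        = map c (rcons (map (bw i) (enum 'I_(m - 2))) (bv m n)).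
  by rewrite map_rcons -map_comp.
have enum_head p (j : 'I_p) s : enum 'I_p = j :: s -> j = 0%N :> nat.
  by case: p j s => [[]//|p] j s; rewrite enum_ordSl => -[<-].
(* Since [m > 2], a page has a first inner vertex; its position is 0, the one where the signature
   may put a negative edge. *)
case E: (enum _) => [|j0 s] /=.
  have := size_enum_ord (m - 2); rewrite E => /esym/eqP.
  by rewrite subn_eq0 leqNgt m_gt2.
have {E} j00 := enum_head _ _ _ E.
rewrite /compatible book_signature_page j00 eqxx andbT -/(compatible _ c).
rewrite {2}/neq_rel /page_start eq_sym; congr andb.
(* The induction allows any current vertex other than [u]. *)
have: bw i j0 != bu m n by [].
elim: s (bw i j0) => [|j s IHs] x xu /=.
  by rewrite /compatible (negPf (book_signature_notu _ _ _)) // eq_sym.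
by rewrite IHs // /compatible (negPf (book_signature_notu _ _ _)) // eq_sym.
Qed.

(** The condition on [uv] stays under the quantifier over pages, because a book without pages has no
    edge [uv]. *)
Lemma proper_book_star n l (c : zero_free_coloring (book_vertex m n) k) :
  (2 < m)%N ->
  reflect (forall i, c (bv m n) != opp_color (c (bu m n)) /\
     path neq_rel (page_start l c i)
       (rcons (page_colors c i) (c (bv m n))))
    (@Defs.proper (book_star m n l) k c).
Proof.
move=> m_gt2; apply: (iffP (proper_with_signatureP _ _)) => cP.
  move=> i; apply/andP; rewrite -cycle_book //.
  apply/cycle_compatibleP => [|x y xyE]; first exact: book_cycle_uniq.
  by apply: cP; apply/bigcupP; exists i.
move=> x y /bigcupP[i _].
apply: (elimT (cycle_compatibleP _ _ (book_cycle_uniq i))).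
by rewrite cycle_book //; apply/andP.
Qed.

(* The new page gets index 0, hence a negative first edge as soon as [l > 1];
   the old ones are shifted by one, which is why [l] drops by one with [n]. *)
Definition add_page n (ct : zero_free_coloring (book_vertex m n) k *
    (m - 2).-tuple (seq_sub (zero_free_colors k))) :
    zero_free_coloring (book_vertex m n.+1) k :=
  [ffun x => match x with
   | inl b => ct.1 (inl b)
   | inr (i, j) =>
     if unlift ord0 i is Some i' then ct.1 (inr (i', j)) else tnth ct.2 j
   end].

Lemma add_page_bij n : bijective (@add_page n).
Proof.
pose rest (c : zero_free_coloring (book_vertex m n.+1) k) :
    zero_free_coloring (book_vertex m n) k :=
  [ffun x => match x with
   | inl b => c (inl b) | inr (i, j) => c (inr (lift ord0 i, j)) end].
exists (fun c => (rest c, page_colors c ord0)) => [[c t]|c].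
  congr pair; first by apply/ffunP=> -[b|[i j]]; rewrite !ffunE ?liftK.
  by apply/eq_from_tnth => j; rewrite tnth_mktuple ffunE /= unlift_none.
apply/ffunP=> -[b|[i j]]; rewrite !ffunE //.
by case: unliftP => [i'|] ->; rewrite ?ffunE ?tnth_mktuple.
Qed.

Lemma proper_add_page n l c t : (2 < m)%N -> (0 < n)%N -> (1 < l)%N ->
  @Defs.proper (book_star m n.+1 l) k (add_page (c, t)) =
  @Defs.proper (book_star m n (l - 1)) k c &&
  path neq_rel (opp_color (c (bu m n))) (rcons t (c (bv m n))).
Proof.
move=> m_gt2 n_gt0 l_gt1; set c' := add_page (c, t).
have uE : c' (bu m n.+1) = c (bu m n) by rewrite ffunE.
have vE : c' (bv m n.+1) = c (bv m n) by rewrite ffunE.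
have p0 : page_colors c' ord0 = t.
  by apply/eq_from_tnth => j; rewrite tnth_mktuple ffunE /= unlift_none.
have pS i : page_colors c' (lift ord0 i) = page_colors c i.
  by apply/eq_from_tnth => j; rewrite !tnth_mktuple ffunE /= liftK.
have s0 : page_start l c' ord0 = opp_color (c (bu m n)).
  by rewrite /page_start uE subn_gt0 l_gt1.
(* Old page [i] becomes page [i + 1], and [i + 1 < l - 1] amounts to [i < (l - 1) - 1]. *)
have sS i : page_start l c' (lift ord0 i) = page_start (l - 1) c i.
  by rewrite /page_start uE lift0 [in RHS]ltn_subRL add1n.
apply/(proper_book_star _ _ m_gt2)/andP
  => [cP|[/(proper_book_star _ _ m_gt2) cP tP] i].
  split; last by have [_] := cP ord0; rewrite p0 s0 vE.
  by apply/(proper_book_star _ _ m_gt2) => i;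
    have := cP (lift ord0 i); rewrite pS sS uE vE.
rewrite uE vE; case: (unliftP ord0 i) => [i'|] ->.
  by rewrite pS sS; apply: cP.
(* The condition on [uv] for the new page is borrowed from an old one, which exists as [0 < n]. *)
by rewrite p0 s0; split=> //; have [] := cP (Ordinal n_gt0).
Qed.

(** Each proper coloring [c] of the smaller book extends to the new page in as many ways as there
    are path colorings from [- c(u)] to [c(v)], a number that does not depend on [c]. *)
Lemma balanced_chromatic_add_page n l : (2 < m)%N -> (0 < n)%N -> (1 < l)%N ->
  (balanced_chromatic (book_star m n.+1 l) k)%:Z =
  (\sum_(0 <= i < (m - 2).+1)
      (-1) ^+ i * ((2 * k)%:Z - 1) ^+ ((m - 2) - i)) *
  (balanced_chromatic (book_star m n (l - 1)) k)%:Z.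
Proof.
move=> m_gt2 n_gt0 l_gt1; rewrite /balanced_chromatic -!sum1dep_card.
rewrite (reindex (@add_page n)) /=; last exact/onW_bij/add_page_bij.
rewrite (eq_bigl (fun ct : _ * (m - 2).-tuple _ =>
  @Defs.proper (book_star m n (l - 1)) k ct.1 &&
  path neq_rel (opp_color (ct.1 (bu m n))) (rcons ct.2 (ct.1 (bv m n)))));
  last by case=> c t; rewrite proper_add_page.
rewrite -(pair_big_dep (fun c => @Defs.proper (book_star m n (l - 1)) k c)
  (fun c (t : (m - 2).-tuple _) => path neq_rel (opp_color (c (bu m n)))
     (rcons t (c (bv m n)))) (fun _ _ => 1%N)) /=.
rewrite -[LHS]natz -[X in _ * X]natz !natr_sum mulr_sumr.
apply: eq_bigr => c cP.
rewrite mulr1 sum1dep_card -/(path_colorings _ _ _) natz path_colorings_neq.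
  by rewrite card_zero_free_colors.
(* The end colors are distinct because the smaller book has a page and so contains the negative edge
   [uv]. *)
have [+ _] := proper_book_star _ _ m_gt2 cP (Ordinal n_gt0).
by rewrite eq_sym.
Qed.

End BookColorings.

Theorem theorem7p9 (m n l k : nat) (hm : (3 <= m)%N) (hn : (2 <= n)%N)
    (hl : (2 <= l)%N) (hln : (l <= uphalf n)%N) (hk : (0 < k)%N) :
  (balanced_chromatic (book_star m n l) k)%:Z =
  (\sum_(0 <= i < (m - 2).+1)
      (-1) ^+ i * ((2 * k)%:Z - 1) ^+ ((m - 2) - i)) *
  (balanced_chromatic (book_star m (n - 1) (l - 1)) k)%:Z.
Proof.
case: n hn {hln} => [|n] // n_gt0.
by rewrite subSS subn0; apply: balanced_chromatic_add_page.
Qed.
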